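(* Let $K\subseteq\mathbb{R}^n$ be compact, let $V=V_{\leq d}$ be the vector space of real polynomials of degree at most $d$ in $n$ variables and let $\phi_1,\dots,\phi_m$ be a basis of $V$. Let $\delta\geq0$ and let $y\in\mathbb{R}^m$ be a vector with components $y_i=\int_K\phi_i\,d\mu+\epsilon_i$, where $\mu$ is a positive discrete measure on $K$ and $\epsilon\in\mathbb{R}^m$ satisfies $\|\epsilon\|_2\leq\delta$. Then the optimal value of $$\min_{\nu\in\mathcal{S}(K)}\|\nu\|_{\rm TV}\quad\text{subject to}\quad\left\|\left(\int_K\phi_i\,d\nu-y_i\right)_{i=1,\dots,m}\right\|_2\leq\delta$$ coincides with the optimal value of the finite-dimensional convex optimization problem $$\sup_{(\vec a,b)\in\mathbb{R}^m\times\mathbb{R}}\left\{\langle\vec a,y\rangle-b\delta\ :\ P=\sum_{i=1}^m a_i\phi_i,\ \|P\|_\infty\leq1,\ \|\vec a\|_2\leq b\right\}.$$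
   Context: $\mathcal{S}(K)$ is the set of all real-valued signed Borel measures on $K$, and $\|\nu\|_{\rm TV}:=\sup\{\int_K f\,d\nu: f\text{ continuous on }K,\ \|f\|_\infty\leq1\}$. $\|P\|_\infty$ denotes the supremum norm of $P$ on $K$. A positive discrete measure on $K$ is a finite combination of Dirac measures at points of $K$ with nonnegative coefficients. *)

(* Defs.v *)
From HB Require Import structures.
From mathcomp Require Import all_boot all_order all_algebra.
From mathcomp Require Import all_classical all_reals all_analysis.
(* The notations of mpoly are not imported: they clash with those of
   mathcomp-analysis. *)
From mathcomp Require mpoly.
Import (canonicals, coercions) mpoly.

Set Implicit Arguments.
Unset Strict Implicit.
Unset Printing Implicit Defensive.

Import Order.TTheory GRing.Theory Num.Theory.
Import numFieldNormedType.Exports.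

Local Open Scope classical_set_scope.
Local Open Scope ring_scope.

Definition borel_rV (R : realType) (n : nat) :=
  g_sigma_algebraType (@open 'rV[R]_n).

Definition peval (R : realType) (n : nat) (p : mpoly.mpoly n R) (x : 'rV[R]_n)
  : R := mpoly.meval (fun j => x ord0 j) p.

Definition poly_le (R : realType) (n d : nat) : set (mpoly.mpoly n R) :=
  [set p : mpoly.mpoly n R |
    forall mon : mpoly.multinom n,
      mon \in mpoly.msupp p -> (mpoly.mdeg mon <= d)%N].

Definition lincomb (R : realType) (n m : nat) (phi : 'I_m -> mpoly.mpoly n R)
  (a : 'rV[R]_m) : mpoly.mpoly n R := \sum_(i < m) a ord0 i *: phi i.

Definition is_basis (R : realType) (n m : nat) (V : set (mpoly.mpoly n R))
  (phi : 'I_m -> mpoly.mpoly n R) : Prop :=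
  [/\ forall i, V (phi i),
      forall a : 'rV[R]_m, lincomb phi a = 0 -> a = 0 &
      forall p, V p -> exists a : 'rV[R]_m, p = lincomb phi a].

(* The library norm on ['rV[R]_m] is the maximum norm. *)
Definition l2norm (R : realType) (m : nat) (v : 'rV[R]_m) : R :=
  Num.sqrt (\sum_(i < m) v ord0 i ^+ 2).

Definition inner (R : realType) (m : nat) (u v : 'rV[R]_m) : R :=
  \sum_(i < m) u ord0 i * v ord0 i.

(* This is -oo, hence at most 1, when K is empty. *)
Definition supnorm (R : realType) (n : nat) (K : set 'rV[R]_n)
  (f : 'rV[R]_n -> R) : \bar R := ereal_sup [set `|f x|%:E | x in K].

(* Signed Borel measures on K are represented by the real-valued signed Borel
   measures on R^n that vanish on the Borel sets disjoint from K. For K closed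
   (in particular compact) the Borel sets of K are the Borel sets of R^n
   contained in K, so restriction to them and extension by
   A |-> nu (A `&` K) identify the two notions. The type of points of K itself
   cannot be used, since a [measurableType] is pointed and K may be empty. *)
Definition signed_measures_on (R : realType) (n : nat) (K : set 'rV[R]_n)
  : set ({charge set (borel_rV R n) -> \bar R}) :=
  [set nu | forall A : set (borel_rV R n),
    measurable A -> A `&` K = set0 -> nu A = 0%E].

(* The integral against nu^+ minus the integral against nu^-, where
   nu = nu^+ - nu^- is the Jordan decomposition; the value does not depend on
   the Hahn decomposition that is chosen. *)
Definition charge_integral d (T : measurableType d) (R : realType)
  (nu : {charge set T -> \bar R}) (D : set T) (f : T -> R) : R :=
  let P := cid (Hahn_decomposition nu) in
  let N := cid (projT2 P) in
  let nuPN := projT2 N in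
  \int[jordan_pos nuPN]_(x in D) f x - \int[jordan_neg nuPN]_(x in D) f x.

Definition tv_norm (R : realType) (n : nat) (K : set 'rV[R]_n)
  (nu : {charge set (borel_rV R n) -> \bar R}) : \bar R :=
  ereal_sup [set (charge_integral nu K f)%:E | f in
    [set f : 'rV[R]_n -> R |
      {within K, continuous f} /\ (supnorm K f <= 1)%E]].

Definition positive_discrete_on (R : realType) (n : nat) (K : set 'rV[R]_n)
  (mu : {measure set (borel_rV R n) -> \bar R}) : Prop :=
  exists (k : nat) (c : 'I_k -> R) (x : 'I_k -> borel_rV R n),
    [/\ forall j, 0 <= c j,
        forall j, K (x j) &
        forall A : set (borel_rV R n), measurable A ->
          mu A = (\sum_(j < k) (c j)%:E * \d_(x j) A)%E].

Definition primal_feasible (R : realType) (n m : nat) (K : set 'rV[R]_n)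
  (phi : 'I_m -> mpoly.mpoly n R) (y : 'rV[R]_m) (delta : R)
  : set ({charge set (borel_rV R n) -> \bar R}) :=
  [set nu | signed_measures_on K nu /\
    l2norm (\row_(i < m) (charge_integral nu K (peval (phi i)) - y ord0 i))
      <= delta].

Definition dual_feasible (R : realType) (n m : nat) (K : set 'rV[R]_n)
  (phi : 'I_m -> mpoly.mpoly n R) : set ('rV[R]_m * R) :=
  [set ab | (supnorm K (peval (lincomb phi ab.1)) <= 1)%E /\
    l2norm ab.1 <= ab.2].

Definition is_minimum (R : realType) (A : set (\bar R)) (v : \bar R) : Prop :=
  A v /\ lbound A v.

(* Main.v *)
(* Let D be the supremum of the dual problem, which is finite because the
   discrete measure mu is feasible.  With Phi(x) = (phi_i(x))_i, among the
   combinations z = sum_j c_j Phi(x_j) of m atoms of K with sum_j |c_j| <= D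
   choose, by compactness, one closest to y.  Moving z towards +/- D Phi(x) uses
   m + 1 atoms, which Caratheodory's reduction in R^m brings back to m without
   increasing sum_j |c_j|; hence a := y - z satisfies
   D |<a, Phi(x)>| <= <a, z> on K.  If |a| > delta, then
   <a, z> = <a, y> - |a|^2 < <a, y> - delta |a|, and normalising a gives a dual
   feasible point of value greater than D.  So |a| <= delta, and
   sum_j c_j delta_{x_j} is feasible of total variation at most D; weak duality
   makes it optimal. *)
Require Import Defs.
From mathcomp Require Import all_boot all_order all_algebra.
From mathcomp Require Import all_classical all_reals all_analysis.
From mathcomp Require Import measurable_realfun.
From mathcomp Require mpoly.
From mathcomp Require Import ring lra.
Import Order.TTheory GRing.Theory Num.Theory.
Import numFieldNormedType.Exports.
Local Open Scope classical_set_scope.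
Local Open Scope ring_scope.

Set Implicit Arguments.
Unset Strict Implicit.

(** * Euclidean inner product and norm *)

Lemma innerC (R : realType) (m : nat) (u v : 'rV[R]_m) : inner u v = inner v u.
Proof. by apply: eq_bigr => i _; rewrite mulrC. Qed.

Lemma innerDl (R : realType) (m : nat) (u v w : 'rV[R]_m) :
  inner (u + v) w = inner u w + inner v w.
Proof. by rewrite -big_split; apply: eq_bigr => i _; rewrite mxE mulrDl. Qed.

Lemma innerZl (R : realType) (m : nat) (k : R) (u v : 'rV[R]_m) :
  inner (k *: u) v = k * inner u v.
Proof. by rewrite mulr_sumr; apply: eq_bigr => i _; rewrite mxE mulrA. Qed.

Lemma innerDr (R : realType) (m : nat) (u v w : 'rV[R]_m) :
  inner u (v + w) = inner u v + inner u w.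
Proof. by rewrite innerC innerDl !(innerC u). Qed.

Lemma innerZr (R : realType) (m : nat) (k : R) (u v : 'rV[R]_m) :
  inner u (k *: v) = k * inner u v.
Proof. by rewrite innerC innerZl innerC. Qed.

Lemma innerBr (R : realType) (m : nat) (u v w : 'rV[R]_m) :
  inner u (v - w) = inner u v - inner u w.
Proof. by rewrite innerDr -scaleN1r innerZr mulN1r. Qed.

Lemma inner_sqrB (R : realType) (m : nat) (k : R) (u v : 'rV[R]_m) :
  inner (u - k *: v) (u - k *: v)
  = inner u u - 2 * k * inner u v + k ^+ 2 * inner v v.
Proof.
rewrite innerBr !(innerC (_ - _)) !innerBr !innerZl !innerZr (innerC v u).
ring.
Qed.

Lemma inner_sqr_ge0 (R : realType) (m : nat) (u : 'rV[R]_m) : 0 <= inner u u.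
Proof. by apply: sumr_ge0 => i _; rewrite -expr2 sqr_ge0. Qed.

Lemma l2norm_ge0 (R : realType) (m : nat) (u : 'rV[R]_m) : 0 <= l2norm u.
Proof. exact: sqrtr_ge0. Qed.

Lemma l2norm_sqr (R : realType) (m : nat) (u : 'rV[R]_m) :
  l2norm u ^+ 2 = inner u u.
Proof.
rewrite sqr_sqrtr; last by apply: sumr_ge0 => i _; rewrite sqr_ge0.
by apply: eq_bigr => i _; rewrite expr2.
Qed.

Lemma l2normZ (R : realType) (m : nat) (k : R) (u : 'rV[R]_m) :
  l2norm (k *: u) = `|k| * l2norm u.
Proof.
apply/eqP; rewrite -(eqrXn2 (n := 2)) ?l2norm_ge0 ?mulr_ge0 ?l2norm_ge0 //.
by rewrite exprMn !l2norm_sqr innerZl innerZr mulrA -expr2 real_normK ?num_real.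
Qed.

Lemma inner_eq0 (R : realType) (m : nat) (u : 'rV[R]_m) :
  inner u u = 0 -> u = 0.
Proof.
move=> /eqP; rewrite psumr_eq0 => [/allP h|i _]; last by rewrite -expr2 sqr_ge0.
apply/rowP => i; rewrite mxE; apply/eqP; move: (h i).
by rewrite mem_index_enum /= mulf_eq0 orbb; apply.
Qed.

(** For [v] nonzero, the squared norm of [<v,v> u - <u,v> v] is nonnegative and equals [<v,v>] times
    [<u,u><v,v> - <u,v>^2]. *)
Lemma cauchy_schwarz (R : realType) (m : nat) (u v : 'rV[R]_m) :
  `|inner u v| <= l2norm u * l2norm v.
Proof.
set U := l2norm u; set V := l2norm v; set W := inner u v.
rewrite -ler_sqr ?nnegrE ?mulr_ge0 ?l2norm_ge0 // real_normK ?num_real //.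
have [v0|vN0] := eqVneq (inner v v) 0.
  by rewrite /W (inner_eq0 v0) -[0](scale0r v) innerZr mul0r expr0n sqr_ge0.
rewrite exprMn !l2norm_sqr -subr_ge0 -(pmulr_rge0 _ (_ : 0 < inner v v)).
  rewrite (_ : _ * _ = inner (inner v v *: u - W *: v) (inner v v *: u - W *: v)).
    exact: inner_sqr_ge0.
  rewrite innerBr !(innerC (_ - _)) !innerBr !innerZl !innerZr (innerC v u) -/W.
  ring.
by rewrite lt_neqAle eq_sym vN0 inner_sqr_ge0.
Qed.

(** * Caratheodory reduction controlling the l1-norm of the coefficients *)

(* Moving along a linear dependence relation, in the direction that does not
   increase the l1-norm, until a coefficient vanishes. *)
Lemma caratheodory_zero (R : realFieldType) (m : nat) (c : 'I_m.+1 -> R)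
    (v : 'I_m.+1 -> 'rV[R]_m) :
  exists (c' : 'I_m.+1 -> R) (i : 'I_m.+1),
    [/\ c' i = 0, \sum_j c' j *: v j = \sum_j c j *: v j
      & \sum_j `|c' j| <= \sum_j `|c j|].
Proof.
have [[i ci0]|cn0] := pselect (exists i, c i = 0); first by exists c, i.
have {}cn0 i : c i != 0 by apply/eqP => ci0; apply: cn0; exists i.
pose A := \matrix_i v i.
(* [A] has m + 1 rows and rank at most m, so its left kernel is nonzero. *)
have [w wN0 wA] : exists2 w : 'rV[R]_m.+1, w != 0 & w *m A = 0.
  have : kermx A != 0.
    by rewrite kermx_eq0 -row_leq_rank -ltnNge ltnS rank_leq_col.
  by case/rowV0Pn => w /sub_kermxP wA wN0; exists w.
have wv : \sum_j w ord0 j *: v j = 0.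
  by move: wA; rewrite mulmx_sum_row => wA; rewrite -[RHS]wA;
     apply: eq_bigr => j _; rewrite rowK.
clear wA.
(* This sum is the initial rate at which the l1-norm of [c - t w] decreases as [t] grows from 0;
   replacing [w] by [- w] flips its sign. *)
wlog s_ge0 : w wN0 wv / 0 <= \sum_j Num.sg (c j) * w ord0 j.
  move=> h; have [/h|s_lt0] := leP 0 (\sum_j Num.sg (c j) * w ord0 j).
    exact.
  apply: (h (- w)); rewrite ?oppr_eq0 //.
    by under eq_bigr do rewrite mxE scaleNr; rewrite sumrN wv oppr0.
  by under eq_bigr do rewrite mxE mulrN; rewrite sumrN oppr_ge0 ltW.
have [k k_gt0] : exists k, 0 < Num.sg (c k) * w ord0 k.
  apply/not_existsP => h.
  have h' j : Num.sg (c j) * w ord0 j <= 0 by rewrite leNgt; apply/negP/h.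
  have s0 : \sum_j - (Num.sg (c j) * w ord0 j) == 0.
    by rewrite sumrN oppr_eq0 eq_le s_ge0 andbT; apply: sumr_le0.
  move: s0; rewrite psumr_eq0 => [/allP s0|j _]; last by rewrite oppr_ge0.
  move/negP: wN0; apply; apply/eqP/rowP => j; rewrite mxE; apply/eqP.
  move: (s0 j); rewrite mem_index_enum oppr_eq0 mulf_eq0 sgr_eq0.
  by rewrite (negPf (cn0 j)); apply.
(* [t] is the first time at which a coefficient of [c - t w] vanishes, and [i] is the index of such
   a coefficient. *)
case: (@arg_minP _ _ _ k (fun j => 0 < Num.sg (c j) * w ord0 j)
  (fun j => `|c j| / (Num.sg (c j) * w ord0 j)) k_gt0) => i.
set t := `|c i| / _ => i_gt0 t_min.
(* No coefficient has changed sign by time [t], so its absolute value is still given by the affine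
   formula. *)
have cE j : `|c j - t * w ord0 j| = `|c j| - t * (Num.sg (c j) * w ord0 j).
  have -> : `|c j| - t * (Num.sg (c j) * w ord0 j)
            = Num.sg (c j) * (c j - t * w ord0 j).
    by rewrite normrEsg; ring.
  rewrite -[LHS]mul1r -(normr1 R) -[1](_ : `|Num.sg (c j)| = 1); last first.
    by rewrite normr_sg cn0.
  rewrite normr_id -normrM ger0_norm // mulrBr -normrEsg.
  have [j_gt0|j_le0] := ltP 0 (Num.sg (c j) * w ord0 j).
    by rewrite mulrCA subr_ge0 -ler_pdivlMr // t_min.
  rewrite mulrCA subr_ge0 (le_trans _ (normr_ge0 _)) // mulr_ge0_le0 //.
  by rewrite divr_ge0 // ltW.
exists (fun j => c j - t * w ord0 j), i; split.
- apply/eqP; rewrite -normr_eq0 cE /t divfK ?subrr //.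
  by rewrite gt_eqF.
- under eq_bigr do rewrite scalerBl -scalerA.
  by rewrite sumrB -scaler_sumr wv scaler0 subr0.
- under eq_bigr do rewrite cE.
  rewrite sumrB -mulr_sumr gerBl mulr_ge0 // divr_ge0 //.
  exact: ltW.
Qed.

(** The atom whose coefficient vanishes is dropped. The others are kept as they are, so they stay in
    any set that contained them. *)
Lemma caratheodory_atoms (R : realFieldType) (m : nat) (T : Type)
    (F : T -> 'rV[R]_m) (c : 'I_m.+1 -> R) (x : 'I_m.+1 -> T) :
  exists (c' : 'I_m -> R) (i : 'I_m.+1),
    \sum_j c' j *: F (x (lift i j)) = \sum_j c j *: F (x j) /\
    \sum_j `|c' j| <= \sum_j `|c j|.
Proof.
have [c' [i [ci0 <- le]]] := @caratheodory_zero R m c (F \o x).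
exists (c' \o lift i), i; split.
  by rewrite [RHS](bigD1_ord i) //= ci0 scale0r add0r.
by apply: le_trans le; rewrite [leRHS](bigD1_ord i) //= ci0 normr0 add0r.
Qed.

(** * The closest combination of atoms and its variational inequality *)

Lemma continuous_sum (R : realType) (T : topologicalType) (n : nat)
    (f : 'I_n -> T -> R) :
  (forall i, continuous (f i)) -> continuous (fun x => \sum_i f i x).
Proof.
by move=> fc; apply: continuous_big => [|i _]; [exact: add_continuous|].
Qed.

(* The admissible tuples of m atoms form a compact set, on which the distance
   of [\sum_j c_j F(x_j)] to y attains its minimum. *)
Lemma exists_closest_atoms (R : realType) (m : nat) (T : topologicalType)
    (K : set T) (F : T -> 'rV[R]_m) (y : 'rV[R]_m) (D : R) :
  compact K -> K !=set0 -> (forall i, continuous (fun x => F x ord0 i)) ->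
  0 <= D ->
  exists (c : 'I_m -> R) (x : 'I_m -> T),
    [/\ forall j, K (x j), \sum_j `|c j| <= D &
      forall (c' : 'I_m -> R) (x' : 'I_m -> T), (forall j, K (x' j)) ->
        \sum_j `|c' j| <= D ->
        inner (y - \sum_j c j *: F (x j)) (y - \sum_j c j *: F (x j)) <=
        inner (y - \sum_j c' j *: F (x' j)) (y - \sum_j c' j *: F (x' j))].
Proof.
move=> Kc [x0 Kx0] Fc D0.
pose C : topologicalType := prod_topology (fun _ : 'I_m => (R * T)%type).
have projc j : continuous (fun f : C => f j).
  exact: (@proj_continuous 'I_m (fun=> (R * T)%type) j).
have fstc j : continuous (fun f : C => (f j).1).
  by move=> f; apply: (continuous_comp (projc j f)); exact: cvg_fst.
have sndc j : continuous (fun f : C => (f j).2).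
  by move=> f; apply: (continuous_comp (projc j f)); exact: cvg_snd.
(* The box is compact by Tychonoff, and the l1 bound cuts out a closed part of it. That bound also
   forces each coefficient into [[-D, D]], so every admissible tuple lies in [A]. *)
pose A : set C := [set f | forall j, (`[- D, D] `*` K) (f j)] `&`
  [set f | \sum_j `|(f j).1| <= D].
have Ac : compact A.
  apply: compact_closedI.
    apply: (@tychonoff 'I_m (fun=> (R * T)%type) (fun=> `[- D, D] `*` K)) => j.
    by apply: compact_setX => //; exact: segment_compact.
  apply: (@preimage_closed _ _ (fun f : C => \sum_j `|(f j).1|) [set r | r <= D]).
    move=> f _; apply: (@continuous_sum R C) => j g.
    by apply: (cvg_comp _ _ (fstc j g)); exact: norm_continuous.
  exact: closed_le.
pose G (f : C) := inner (y - \sum_j (f j).1 *: F (f j).2)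
                        (y - \sum_j (f j).1 *: F (f j).2).
have Gc : continuous G.
  apply: (@continuous_sum R C) => i.
  have h : continuous (fun g : C => (y - \sum_j (g j).1 *: F (g j).2) ord0 i).
    rewrite (_ : (fun g : C => _) =
        fun g : C => y ord0 i - \sum_j (g j).1 * F (g j).2 ord0 i); last first.
      apply/funext => g; rewrite !mxE summxE; congr (_ - _).
      by apply: eq_bigr => j _; rewrite mxE.
    move=> f; apply: continuousB; first exact: cst_continuous.
    apply: (@continuous_sum R C) => j {}f.
    apply: (@continuousM R C); first exact: fstc.
    exact: (@continuous_comp C T R (fun g => (g j).2) (fun t => F t ord0 i) f
      (sndc j f) (Fc i _)).
  by move=> f; apply: (@continuousM R C); exact: h.
have memA (c : 'I_m -> R) (x : 'I_m -> T) : (forall j, K (x j)) ->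
    \sum_j `|c j| <= D -> A (fun j => (c j, x j)).
  move=> Kx cD; split => // j; split => //=.
  rewrite in_itv /= -ler_norml (le_trans _ cD) //.
  by rewrite (bigD1 j) //= lerDl sumr_ge0.
have [f /set_mem [Af fD] fmin] : exists2 f, f \in A &
    forall g, g \in A -> G f <= G g.
  apply: compact_EVT_min Ac _.
    exists (fun j => (0, x0)); apply: memA => //.
    by rewrite big1 // => j _; rewrite normr0.
  exact: continuous_subspaceT.
exists (fun j => (f j).1), (fun j => (f j).2); split => // [j|c' x' Kx' cD'].
  by case: (Af j).
by apply: (fmin (fun j => (c' j, x' j))); apply/mem_set/memA.
Qed.

(** This is division by [s] followed by [s -> 0], done with one explicit value of [s]. *)
Lemma first_order_le0 (R : realFieldType) (p q : R) :
  0 <= q -> (forall s, 0 <= s <= 1 -> 2 * s * p <= s ^+ 2 * q) -> p <= 0.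
Proof.
move=> q0 h; rewrite leNgt; apply/negP => p0.
have q1 : 0 < q + 1 + p by lra.
(* With this [s], which is in []0, 1]] if [p > 0], one gets [s q = p - s (1 + p) < p], against
   [2 p <= s q]. *)
have := h (p / (q + 1 + p)).
set s := p / _.
have s0 : 0 < s by rewrite divr_gt0.
have s1 : s <= 1 by rewrite ler_pdivrMr //; lra.
have sq : s * (q + 1 + p) = p by rewrite divfK // gt_eqF.
rewrite ltW // s1 => /(_ isT).
have -> : s ^+ 2 * q = s * (p - s * (1 + p)) by rewrite -{1}sq; ring.
rewrite mulrAC [leLHS]mulrC ler_pM2l //.
have : 0 < s * (1 + p) by rewrite mulr_gt0 //; lra.
lra.
Qed.

(* Variational inequality for the closest point, tested against one more atom;
   the resulting m + 1 atoms are brought back to m by Caratheodory. *)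
Lemma exists_atoms_normal (R : realType) (m : nat) (T : topologicalType)
    (K : set T) (F : T -> 'rV[R]_m) (y : 'rV[R]_m) (D : R) :
  compact K -> K !=set0 -> (forall i, continuous (fun x => F x ord0 i)) ->
  0 <= D ->
  exists (c : 'I_m -> R) (x : 'I_m -> T),
    [/\ forall j, K (x j), \sum_j `|c j| <= D &
      let z := \sum_j c j *: F (x j) in
      forall x', K x' -> D * `|inner (y - z) (F x')| <= inner (y - z) z].
Proof.
move=> Kc K0 Fc D0.
have [c [x [Kx cD cmin]]] := exists_closest_atoms y Kc K0 Fc D0.
exists c, x; split => // z x' Kx'; set a := y - z.
(* Used with [e = D] and [e = - D], which together give the absolute value. *)
have key e : `|e| <= D -> inner a (e *: F x') <= inner a z.
  move=> eD; set w := e *: F x'; rewrite -subr_le0 -innerBr.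
  apply: (@first_order_le0 _ _ (inner (w - z) (w - z))).
    exact: inner_sqr_ge0.
  move=> s /andP[s0 s1].
  (* The m + 1 atoms of [(1 - s) z + s w]: the new atom has index 0, and the l1-norm is at most
     [(1 - s) D + s D = D]. *)
  pose c1 (j : 'I_m.+1) := if unlift ord0 j is Some k then (1 - s) * c k
                           else s * e.
  pose x1 (j : 'I_m.+1) := if unlift ord0 j is Some k then x k else x'.
  have [c2 [i [E le]]] := caratheodory_atoms F c1 x1.
  have /cmin/(_ _) : forall j, K (x1 (lift i j)).
    by move=> j; rewrite /x1; case: unliftP.
  move=> /(_ c2); rewrite E -/z -/a.
  have -> : \sum_j c1 j *: F (x1 j) = z + s *: (w - z).
    rewrite big_ord_recl /c1 /x1 unlift_none.
    under eq_bigr do rewrite liftK -scalerA.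
    rewrite -scaler_sumr -/z scalerBl scale1r scalerBr scalerA.
    by rewrite addrC addrA addrAC -addrA [- _ + _]addrC.
  have -> : y - (z + s *: (w - z)) = a - s *: (w - z).
    by rewrite opprD addrA.
  have c2D : \sum_j `|c2 j| <= D.
    apply: (le_trans le); rewrite big_ord_recl /c1 unlift_none.
    under eq_bigr do rewrite liftK normrM.
    rewrite -mulr_sumr normrM (ger0_norm s0) (@ger0_norm _ (1 - s)) ?subr_ge0 //.
    have := ler_wpM2l s0 eD.
    have := @ler_wpM2l _ (1 - s) _ _ _ cD; rewrite subr_ge0 => /(_ s1).
    lra.
  move=> /(_ c2D).
  set b := w - z.
  by rewrite inner_sqrB; lra.
rewrite -[D]ger0_norm // -normrM.
have [_|_] := ger0P (D * inner a (F x')).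
  by rewrite -innerZr key // ger0_norm.
by rewrite -mulNr -innerZr key // normrN ger0_norm.
Qed.

(** Strong duality for an abstract feature map [F]: a residual longer than [delta] could be rescaled
    to a dual point of value above [D]. *)
Lemma exists_feasible_atoms (R : realType) (m : nat) (T : topologicalType)
    (K : set T) (F : T -> 'rV[R]_m) (y : 'rV[R]_m) (delta D : R) :
  compact K -> K !=set0 -> (forall i, continuous (fun x => F x ord0 i)) ->
  0 <= delta -> 0 <= D ->
  (forall a, (forall x, K x -> `|inner a (F x)| <= 1) ->
    inner a y - l2norm a * delta <= D) ->
  exists (c : 'I_m -> R) (x : 'I_m -> T),
    [/\ forall j, K (x j), \sum_j `|c j| <= D &
      l2norm (\sum_j c j *: F (x j) - y) <= delta].
Proof.
move=> Kc K0 Fc delta0 D0 dual.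
have [c [x [Kx cD]]] := exists_atoms_normal y Kc K0 Fc D0.
set z := \sum_j _; move=> /= zmax; exists c, x; split => //.
rewrite -opprB -scaleN1r l2normZ normrN1 mul1r leNgt; apply/negP.
set a := y - z => lt.
have [x0 /set_mem Kx0 xmax] : exists2 x0, x0 \in K &
    forall t, t \in K -> `|inner a (F t)| <= `|inner a (F x0)|.
  apply: compact_EVT_max => //; apply: continuous_subspaceT => t.
  apply: (@continuous_comp _ _ _ (fun t => inner a (F t)) (fun r : R => `|r|));
    last exact: norm_continuous.
  apply: continuous_sum => i {}t; apply: cvgM; [exact: cvg_cst|exact: Fc].
set M := `|inner a (F x0)| in xmax.
(* Here [<a,y> = |a|^2 + <a,z>] with [<a,z> >= D M], and [|a|^2 > delta |a|]. *)
have q_gt : D * M < inner a y - l2norm a * delta.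
  apply: (le_lt_trans (zmax _ Kx0)).
  have -> : inner a y = inner a a + inner a z by rewrite -innerDr subrK.
  have : 0 < l2norm a * (l2norm a - delta).
    by rewrite mulr_gt0 ?subr_gt0 // (le_lt_trans delta0).
  by rewrite -l2norm_sqr expr2; lra.
(* The vector [t a] satisfies the dual constraint as soon as [t M <= 1], and the dual value is
   homogeneous in [t]. *)
have scaled t : 0 <= t -> t * M <= 1 ->
    t * (inner a y - l2norm a * delta) <= D.
  move=> t0 tM; rewrite mulrBr mulrA -innerZl -{2}(ger0_norm t0) -l2normZ.
  apply: dual => x1 Kx1; rewrite innerZl normrM ger0_norm //.
  by apply: le_trans tM; rewrite ler_wpM2l // xmax // mem_set.
set q := _ - _ in q_gt scaled.
have M0 : 0 <= M by exact: normr_ge0.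
have q0 : 0 < q by rewrite (le_lt_trans _ q_gt) // mulr_ge0.
(* If [M = 0], every [t >= 0] is allowed, and this choice would give [D + 1 <= D]. Otherwise
   [t = 1 / M] contradicts [q_gt]. *)
have [M_0|MN0] := eqVneq M 0.
  have t0 : 0 <= (D + 1) / q by apply: divr_ge0; [lra|exact: ltW].
  have := scaled _ t0; rewrite M_0 mulr0 divfK ?gt_eqF // => /(_ ler01).
  lra.
have {}M0 : 0 < M by rewrite lt_neqAle eq_sym MN0.
have := scaled M^-1; rewrite invr_ge0 (ltW M0) mulVf // lexx => /(_ isT isT).
by rewrite mulrC ler_pdivrMr // leNgt q_gt.
Qed.

(** * Integration against discrete measures and charges *)

Lemma sum_diracE d (T : measurableType d) (R : realType) (k : nat)
    (c : 'I_k -> R) (x : 'I_k -> T) (A : set T) :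
  (\sum_j (c j)%:E * \d_(x j) A)%E = (\sum_j c j * \1_A (x j))%:E.
Proof. by rewrite -sumEFin. Qed.

(** Provides a reference measure built by induction from library operations, whose integrals are
    computable; measures with the same values on measurable sets inherit them. *)
Lemma exists_discrete_measure d (T : measurableType d) (R : realType) (k : nat)
    (c : 'I_k -> R) (x : 'I_k -> T) :
  (forall j, 0 <= c j) ->
  exists mu : {measure set T -> \bar R},
    (forall A, mu A = (\sum_j (c j)%:E * \d_(x j) A)%E) /\
    forall (D : set T) (f : T -> \bar R), measurable D -> measurable_fun D f ->
      (forall t, D t -> 0 <= f t)%E -> (forall j, D (x j)) ->
      (\int[mu]_(t in D) f t)%E = (\sum_j (c j)%:E * f (x j))%E.
Proof.
elim: k c x => [|k IHk] c x c0.
  exists mzero; split => [A|D f mD mf f0 Dx]; first by rewrite big_ord0.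
  by rewrite big_ord0 integral_measure_zero.
have [mu [muE intE]] := IHk (c \o lift ord0) (x \o lift ord0) (fun j => c0 _).
exists (measure_add (mscale (NngNum (c0 ord0)) (dirac (x ord0))) mu).
split => [A|D f mD mf f0 Dx]; first by rewrite [LHS]measure_addE muE big_ord_recl.
rewrite ge0_integral_measure_add // ge0_integral_mscale // integral_dirac //.
rewrite diracE mem_set // mul1e intE // => [|j]; last exact: Dx.
by rewrite [RHS]big_ord_recl.
Qed.

Lemma Rintegral_discrete d (T : measurableType d) (R : realType) (k : nat)
    (c : 'I_k -> R) (x : 'I_k -> T) (mu : {measure set T -> \bar R})
    (D : set T) (f : T -> R) :
  (forall j, 0 <= c j) ->
  (forall A, measurable A -> mu A = (\sum_j (c j)%:E * \d_(x j) A)%E) ->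
  measurable D -> (forall j, D (x j)) -> measurable_fun D f ->
  \int[mu]_(t in D) f t = \sum_j c j * f (x j).
Proof.
move=> c0 muE mD Dx mf.
have [mu0 [mu0E intE]] := exists_discrete_measure x c0.
have mfE : measurable_fun D (EFin \o f) by exact/measurable_EFinP.
rewrite /Rintegral (@eq_measure_integral _ _ _ D mu0 mu); last first.
  by move=> A mA _; rewrite mu0E; exact: muE.
rewrite integralE !intE //; [|exact: measurable_funeneg|exact: measurable_funepos].
rewrite funerpos funerneg /= !sumEFin -EFinB /= -sumrB.
apply: eq_bigr => j _; rewrite -mulrBr.
by rewrite -[in RHS](funrposBneg f).
Qed.

Lemma charge_integralE d (T : measurableType d) (R : realType)
    (nu : {charge set T -> \bar R}) :
  exists P N (nuPN : hahn_decomposition nu P N), forall D f,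
    charge_integral nu D f = \int[jordan_pos nuPN]_(t in D) f t
                           - \int[jordan_neg nuPN]_(t in D) f t.
Proof.
by exists _, _, (projT2 (cid (projT2 (cid (Hahn_decomposition nu))))).
Qed.

(** Since atoms may coincide, splitting [c] into positive and negative parts need not give the
    Jordan decomposition. Both splittings have difference [nu], so crosswise sums agree as measures
    ([balance]); boundedness of [f] makes all integrals finite, so they can be rearranged. *)
Lemma charge_integral_discrete d (T : measurableType d) (R : realType) (k : nat)
    (c : 'I_k -> R) (x : 'I_k -> T) (nu : {charge set T -> \bar R})
    (D : set T) (f : T -> R) :
  (forall A, measurable A -> nu A = (\sum_j (c j)%:E * \d_(x j) A)%E) ->
  measurable D -> (forall j, D (x j)) -> measurable_fun D f ->
  [bounded f t | t in D] ->
  charge_integral nu D f = \sum_j c j * f (x j).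
Proof.
move=> nuE mD Dx mf bf; have [P [N [nuPN ->]]] := charge_integralE nu.
have cp0 : forall j, 0 <= c^\+ j by exact: funrpos_ge0.
have cn0 : forall j, 0 <= c^\- j by exact: funrneg_ge0.
have cE j : c j = c^\+ j - c^\- j by rewrite -[in LHS](funrposBneg c).
have [mup [mupE _]] := exists_discrete_measure x cp0.
have [mun [munE _]] := exists_discrete_measure x cn0.
pose jp : {finite_measure set T -> \bar R} := jordan_pos nuPN.
pose jn : {finite_measure set T -> \bar R} := jordan_neg nuPN.
have mfE : measurable_fun D (EFin \o f) by exact/measurable_EFinP.
have balance A : measurable A ->
    (measure_add jp mun A = measure_add jn mup A)%E.
  move=> mA; rewrite !measure_addE.
  have fjp : jp A \is a fin_num by exact: fin_num_measure.
  have fjn : jn A \is a fin_num by exact: fin_num_measure.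
  have E : \sum_j c j * \1_A (x j) = fine (jp A) - fine (jn A).
    apply: EFin_inj; rewrite -sum_diracE -nuE // EFinB !fineK //.
    by rewrite (jordan_decomp nuPN mA) /cadd /= cscaleN1.
  rewrite mupE munE !sum_diracE -[X in (X + _ = _)%E]fineK //.
  rewrite -[X in (_ = X + _)%E]fineK // -!EFinD; congr (_%:E).
  transitivity (fine (jn A) + (\sum_j c j * \1_A (x j) + \sum_j c^\- j * \1_A (x j))).
    by rewrite E; ring.
  congr (_ + _).
  rewrite -big_split; apply: eq_bigr => j _ /=; rewrite -mulrDl; congr (_ * _).
  by rewrite cE subrK.
have fin_discrete (c' : 'I_k -> R) (m : {measure set T -> \bar R}) :
    (forall A, m A = (\sum_j (c' j)%:E * \d_(x j) A)%E) -> (m D < +oo)%E.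
  by move=> ->; rewrite sum_diracE ltry.
have intf (m : {measure set T -> \bar R}) :
    (m D < +oo)%E -> m.-integrable D (EFin \o f).
  by move=> mfin; exact: measurable_bounded_integrable.
have ijp : jp.-integrable D (EFin \o f).
  by apply: intf; rewrite -ge0_fin_numE // fin_num_measure.
have ijn : jn.-integrable D (EFin \o f).
  by apply: intf; rewrite -ge0_fin_numE // fin_num_measure.
have imup := intf _ (fin_discrete _ _ mupE).
have imun := intf _ (fin_discrete _ _ munE).
have := @eq_measure_integral _ _ _ D _ _ (EFin \o f) (fun A mA _ => balance A mA).
rewrite !integral_measure_add // => /(congr1 fine).
rewrite [LHS]fineD ?integrable_fin_num // [RHS]fineD ?integrable_fin_num // => E.
have Ep : \int[mup]_(t in D) f t = \sum_j c^\+ j * f (x j).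
  by apply: Rintegral_discrete => // A _; exact: mupE.
have En : \int[mun]_(t in D) f t = \sum_j c^\- j * f (x j).
  by apply: Rintegral_discrete => // A _; exact: munE.
have -> : \sum_j c j * f (x j) = \int[mup]_(t in D) f t - \int[mun]_(t in D) f t.
  by rewrite Ep En -sumrB; apply: eq_bigr => j _; rewrite -mulrBl -cE.
move: E; rewrite /Rintegral; lra.
Qed.

Lemma exists_discrete_charge d (T : measurableType d) (R : realType) (k : nat)
    (c : 'I_k -> R) (x : 'I_k -> T) :
  exists nu : {charge set T -> \bar R},
    forall A, nu A = (\sum_j (c j)%:E * \d_(x j) A)%E.
Proof.
elim: k c x => [|k IHk] c x; first by exists czero => A; rewrite big_ord0.
have [nu nuE] := IHk (c \o lift ord0) (x \o lift ord0).
exists (cadd (cscale (c ord0) (charge_of_finite_measure (dirac (x ord0)))) nu).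
by move=> A; rewrite big_ord_recl; congr (_ + _)%E; exact: nuE.
Qed.

(** Both Jordan parts are finite measures, for which bounded measurable functions are integrable. *)
Lemma charge_integral_lincomb d (T : measurableType d) (R : realType)
    (nu : {charge set T -> \bar R}) (D : set T) (k : nat) (a : 'I_k -> R)
    (f : 'I_k -> T -> R) :
  measurable D -> (forall i, measurable_fun D (f i)) ->
  (forall i, [bounded f i t | t in D]) ->
  charge_integral nu D (fun t => \sum_i a i * f i t)
  = \sum_i a i * charge_integral nu D (f i).
Proof.
move=> mD mf bf; have [P [N [nuPN charge_intE]]] := charge_integralE nu.
rewrite charge_intE.
under [RHS]eq_bigr do rewrite charge_intE.
have lin (m : {finite_measure set T -> \bar R}) :
    \int[m]_(t in D) (\sum_i a i * f i t)
    = \sum_i a i * \int[m]_(t in D) f i t.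
  have intf i : m.-integrable D (EFin \o f i).
    apply: measurable_bounded_integrable => //.
    by rewrite -ge0_fin_numE // fin_num_measure.
  rewrite /Rintegral.
  under eq_integral do rewrite -sumEFin.
  rewrite integral_sum //; last first.
    by move=> i; apply: (@integrableZl _ _ _ _ _ mD (a i) _ (intf i)).
  rewrite -sum_fine; last first.
    move=> i _; apply: integrable_fin_num => //.
    exact: (@integrableZl _ _ _ _ _ mD (a i) _ (intf i)).
  by apply: eq_bigr => i _; exact: RintegralZl.
rewrite !lin -sumrB; apply: eq_bigr => i _; by rewrite mulrBr.
Qed.

(** * Continuous functions on a compact set: measurability and boundedness *)

Section borel_compact.
Context (R : realType) (n : nat) (K : set 'rV[R]_n).
Hypothesis Kc : compact K.

Let K_closed : closed K.
Proof. by apply: compact_closed => //; exact: norm_hausdorff. Qed.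

Lemma measurable_open_rV (U : set 'rV[R]_n) :
  open U -> measurable (U : set (borel_rV R n)).
Proof. by move=> oU; exact: sub_sigma_algebra. Qed.

Lemma measurable_compact_rV : measurable (K : set (borel_rV R n)).
Proof.
rewrite -[K]setCK; apply: measurableC; apply: measurable_open_rV.
exact: closed_openC.
Qed.

Lemma measurable_within_continuous (f : 'rV[R]_n -> R) :
  {within K, continuous f} ->
  measurable_fun (K : set (borel_rV R n)) (f : borel_rV R n -> R).
Proof.
move=> /continuousP fc _.
apply: (measurability _ (RGenOpens.measurableE R)); last first.
  exact: measurable_compact_rV.
move=> _ [_ [a [b ->] <-]].
(* The preimage is only relatively open: its trace on [K] is that of an open set [U], and [K] itself
   is Borel. *)
have /open_subspaceP[U oU UE] : open (f @^-1` `]a, b[ : set (subspace K)).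
  exact/fc/interval_open.
rewrite setIC -UE.
apply: measurableI; [exact: measurable_open_rV|exact: measurable_compact_rV].
Qed.

Lemma bounded_within_continuous (f : 'rV[R]_n -> R) :
  {within K, continuous f} -> [bounded f x | x in K].
Proof.
move=> fc; have := compact_bounded (continuous_compact fc Kc).
move=> [M [Mr h]]; exists M; split => // r Mlt t Kt.
by apply: (h _ Mlt); exists t.
Qed.

End borel_compact.

(** * Polynomial evaluation and the sup-norm constraint *)

Lemma peval_continuous (R : realType) (n : nat) (p : mpoly.mpoly n R) :
  continuous (peval p : 'rV[R]_n -> R).
Proof.
rewrite /peval; under eq_fun do rewrite mpoly.mevalE.
apply: continuous_big => [|mon _]; first exact: add_continuous.
move=> x; apply: continuousM; first exact: cst_continuous.
move: x; apply: continuous_big => [|i _]; first exact: mul_continuous.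
move=> x.
apply: (@continuous_comp _ _ _ (fun v : 'rV[R]_n => v ord0 i)
  (fun r : R => r ^+ mpoly.fun_of_multinom mon i)).
  exact: coord_continuous.
exact: exprn_continuous.
Qed.

Lemma peval_lincomb (R : realType) (n m : nat) (phi : 'I_m -> mpoly.mpoly n R)
    (a : 'rV[R]_m) (x : 'rV[R]_n) :
  peval (lincomb phi a) x = \sum_i a ord0 i * peval (phi i) x.
Proof.
rewrite /peval /lincomb (big_morph _ (mpoly.mevalD _) (mpoly.meval0 _)).
by apply: eq_bigr => i _; exact: mpoly.mevalZ.
Qed.

Lemma supnorm_le1 (R : realType) (n : nat) (K : set 'rV[R]_n)
    (f : 'rV[R]_n -> R) :
  (supnorm K f <= 1)%E <-> forall x, K x -> `|f x| <= 1.
Proof.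
split => [h x Kx|h].
  by rewrite -lee_fin; apply: le_trans h; apply: ereal_sup_ubound; exists x.
by apply: ge_ereal_sup => _ [x Kx <-]; rewrite lee_fin; exact: h.
Qed.

(** * Weak duality, and feasible charges made of atoms *)

Section duality.
Context (R : realType) (n m : nat) (K : set 'rV[R]_n).
Context (phi : 'I_m -> mpoly.mpoly n R).
Hypothesis Kc : compact K.

Let mK := measurable_compact_rV Kc.

(** The polynomial of [a] is a test function for the total variation. Its integral is
    [<a,y> + <a,r>] with [r] the residual, and [<a,r> >= - b delta] by Cauchy-Schwarz. *)
Lemma weak_duality (nu : {charge set (borel_rV R n) -> \bar R})
    (y : 'rV[R]_m) (delta : R) (ab : 'rV[R]_m * R) :
  0 <= delta -> primal_feasible K phi y delta nu -> dual_feasible K phi ab ->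
  ((inner ab.1 y - ab.2 * delta)%:E <= tv_norm K nu)%E.
Proof.
case: ab => a b /= delta0 [_]; set r := \row_i _ => rle [/= Pa ab].
have Pc := @continuous_subspaceT _ _ K _ (@peval_continuous R n (lincomb phi a)).
apply: le_trans (_ : _ <= (charge_integral nu K (peval (lincomb phi a)))%:E)%E _;
  last by apply: ereal_sup_ubound; exists (peval (lincomb phi a)).
have -> : peval (lincomb phi a) = fun x => \sum_i a ord0 i * peval (phi i) x.
  by apply/funext => x; exact: peval_lincomb.
have phic i := @continuous_subspaceT _ _ K _ (@peval_continuous R n (phi i)).
rewrite (@charge_integral_lincomb _ (borel_rV R n)) //; last first.
- by move=> i; exact: bounded_within_continuous.
- by move=> i; exact: measurable_within_continuous.
have -> : \sum_i a ord0 i * charge_integral nu K (peval (phi i))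
          = inner a r + inner a y.
  rewrite -innerDr; apply: eq_bigr => i _.
  by rewrite !mxE subrK.
rewrite lee_fin.
have := ler_norml (inner a r) (l2norm a * l2norm r).
rewrite cauchy_schwarz => /esym /andP[h _].
have : l2norm a * l2norm r <= b * delta by rewrite ler_pM ?l2norm_ge0.
lra.
Qed.

Lemma exists_discrete_feasible (y : 'rV[R]_m) (delta D : R) (k : nat)
    (c : 'I_k -> R) (x : 'I_k -> 'rV[R]_n) :
  (forall j, K (x j)) -> \sum_j `|c j| <= D ->
  l2norm (\sum_j c j *: (\row_i peval (phi i) (x j)) - y) <= delta ->
  exists2 nu, primal_feasible K phi y delta nu & (tv_norm K nu <= D%:E)%E.
Proof.
move=> Kx cD le_delta.
have [nu nuE] := @exists_discrete_charge _ (borel_rV R n) R _ c x.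
have nu_int (f : 'rV[R]_n -> R) : {within K, continuous f} ->
    charge_integral nu K f = \sum_j c j * f (x j).
  move=> fc; apply: (@charge_integral_discrete _ (borel_rV R n)) => //.
  - exact: measurable_within_continuous.
  - exact: bounded_within_continuous.
exists nu; first split.
- move=> A mA AK; rewrite nuE big1 // => j _; rewrite diracE memNset ?mule0 //.
  by move=> Ax; have : (A `&` K) (x j) by []; rewrite AK.
- rewrite (_ : \row_i _ = \sum_j c j *: (\row_i peval (phi i) (x j)) - y) //.
  apply/rowP => i; rewrite !mxE summxE nu_int.
    by congr (_ - _); apply: eq_bigr => j _; rewrite !mxE.
  by apply: continuous_subspaceT; exact: peval_continuous.
- apply: ge_ereal_sup => _ [f [fc /supnorm_le1 f1] <-].
  rewrite nu_int // lee_fin; apply: le_trans cD; apply: ler_sum => j _.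
  rewrite (le_trans (ler_norm _)) // normrM ler_piMr //; exact: f1.
Qed.

End duality.

(** * Equality of the optimal values and attainment of the minimum *)

Set Strict Implicit.
Unset Implicit Arguments.

Theorem theorem1p5 (R : realType) (n d m : nat) (K : set 'rV[R]_n)
  (phi : 'I_m -> mpoly.mpoly n R) (delta : R) (y eps : 'rV[R]_m)
  (mu : {measure set (borel_rV R n) -> \bar R})
  (K_compact : compact K)
  (phi_basis : is_basis (@poly_le R n d) phi)
  (delta_ge0 : 0 <= delta)
  (mu_discrete : positive_discrete_on K mu)
  (eps_le : l2norm eps <= delta)
  (y_def : forall i : 'I_m,
    y ord0 i = \int[mu]_(x in K) peval (phi i) x + eps ord0 i) :
  is_minimum [set tv_norm K nu | nu in primal_feasible K phi y delta]
    (ereal_sup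
      [set (inner ab.1 y - ab.2 * delta)%:E | ab in dual_feasible K phi]).
Proof.
have [k [w [p [w0 Kp muE]]]] := mu_discrete.
have yE a : inner a y
    = \sum_j w j * peval (lincomb phi a) (p j) + inner a eps.
  have -> : y = \sum_j w j *: (\row_i peval (phi i) (p j)) + eps.
    apply/rowP => i; rewrite y_def !mxE summxE; congr (_ + _).
    rewrite (@Rintegral_discrete _ (borel_rV R n) _ _ w p) //.
    - by apply: eq_bigr => j _; rewrite !mxE.
    - exact: measurable_compact_rV.
    - apply: measurable_within_continuous => //.
      by apply: continuous_subspaceT; exact: peval_continuous.
  rewrite innerDr; congr (_ + _); rewrite innerC.
  rewrite /inner; under eq_bigr do rewrite summxE mulr_suml.
  rewrite exchange_big; apply: eq_bigr => j _.
  rewrite peval_lincomb mulr_sumr; apply: eq_bigr => i _.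
  by rewrite !mxE -mulrA (mulrC (a _ _)).
(* The total mass of [mu] bounds every dual value, the noise term [<a,eps>] being absorbed by
   [b delta]; hence [v] is finite. *)
have value_le (ab : 'rV[R]_m * R) : dual_feasible K phi ab ->
    inner ab.1 y - ab.2 * delta <= \sum_j w j.
  case: ab => a b [/= /supnorm_le1 Pa ab].
  have h1 : \sum_j w j * peval (lincomb phi a) (p j) <= \sum_j w j.
    apply: ler_sum => j _; rewrite ler_piMr //.
    exact: le_trans (ler_norm _) (Pa _ (Kp j)).
  have h2 : inner a eps <= b * delta.
    apply: le_trans (ler_norm _) _; apply: le_trans (cauchy_schwarz _ _) _.
    by rewrite ler_pM ?l2norm_ge0.
  rewrite yE; lra.
set v := ereal_sup _.
have feasible0 : dual_feasible K phi (0, 0).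
  have zero_sum (F : 'I_m -> R) : \sum_i (0 : 'rV[R]_m) ord0 i * F i = 0.
    by rewrite big1 // => i _; rewrite mxE mul0r.
  split => /=.
    by apply/supnorm_le1 => x _; rewrite peval_lincomb zero_sum normr0.
  by rewrite -(scale0r 0) l2normZ normr0 mul0r.
have v0 : (0 <= v)%E.
  apply: ereal_sup_ubound; exists (0, 0) => //=.
  by rewrite -(scale0r 0) innerZl !mul0r subrr.
have vfin : v \is a fin_num.
  rewrite ge0_fin_numE //; apply: le_lt_trans (ltry (\sum_j w j)).
  by apply: ge_ereal_sup => _ [ab fab <-]; rewrite lee_fin; exact: value_le.
have weak nu : primal_feasible K phi y delta nu -> (v <= tv_norm K nu)%E.
  move=> fnu; apply: ge_ereal_sup => _ [ab fab <-].
  exact: (weak_duality K_compact delta_ge0 fnu fab).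
split; last by move=> _ [nu fnu <-]; exact: weak.
suff [nu fnu le_v] : exists2 nu, primal_feasible K phi y delta nu &
    (tv_norm K nu <= (fine v)%:E)%E.
  exists nu => //; apply/eqP; rewrite eq_le weak // andbT.
  by rewrite -[leRHS]fineK.
(* For empty [K] the measure [mu] has no atoms, so [y = eps] and the zero charge is feasible. *)
have [K0|K0] := pselect (K !=set0); last first.
  have k0 : k = 0%N.
    case: k w p w0 Kp muE {yE value_le vfin} => // k w p w0 Kp.
    by case: K0; exists (p ord0).
  subst k.
  apply: (@exists_discrete_feasible _ _ _ _ _ _ _ _ _ 0 w p) => //.
    by rewrite big_ord0 fine_ge0.
  rewrite big_ord0 (_ : 0 - y = (-1) *: eps).
    by rewrite l2normZ normrN1 mul1r.
  rewrite sub0r scaleN1r; congr (- _); apply/rowP => i.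
  rewrite y_def (@Rintegral_discrete _ (borel_rV R n) _ _ w p) //.
  - by rewrite big_ord0 add0r.
  - exact: measurable_compact_rV.
  - apply: measurable_within_continuous => //.
    by apply: continuous_subspaceT; exact: peval_continuous.
have [c [x [Kx cD le_delta]]] : exists (c : 'I_m -> R) (x : 'I_m -> 'rV[R]_n),
    [/\ forall j, K (x j), \sum_j `|c j| <= fine v &
      l2norm (\sum_j c j *: (\row_i peval (phi i) (x j)) - y) <= delta].
  apply: (@exists_feasible_atoms R m 'rV[R]_n K
    (fun x => \row_i peval (phi i) x)) => //.
  - move=> i; under eq_fun do rewrite mxE; exact: peval_continuous.
  - exact: fine_ge0.
  move=> a Pa; rewrite -lee_fin fineK //; apply: ereal_sup_ubound.
  (* For fixed [a], [b = |a|] is the smallest admissible value and so gives the largest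
     objective. *)
  exists (a, l2norm a) => //; split => //=; apply/supnorm_le1 => x Kx.
  rewrite peval_lincomb; apply: le_trans (Pa _ Kx); rewrite le_eqVlt.
  by apply/orP; left; apply/eqP; congr `|_|; apply: eq_bigr => i _; rewrite mxE.
exact: exists_discrete_feasible le_delta.
Qed.
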